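(* For each locally finite metric space $(Z,d)$ and each real $p>0$, there exists a Lipschitz injection $f:Z\to\ell_p$.
   Context: A metric space is locally finite if every ball of finite radius is a finite set. $\ell_p$ is the space of real sequences $x=(x_n)$ with $\sum_n|x_n|^p<\infty$, with the metric $\|x-y\|_p=(\sum_n|x_n-y_n|^p)^{1/p}$ if $p\geq 1$ and the usual metric $\sum_n|x_n-y_n|^p$ if $0<p<1$. A Lipschitz injection is an injective map $f$ for which there is a constant $K\ge 0$ such that the distance between $f(x)$ and $f(y)$ is at most $K\,d(x,y)$ for all $x,y\in Z$; nothing is required of the inverse. *)

(* Defs.v *)
From HB Require Import structures.
From mathcomp Require Import all_boot all_order all_algebra.
From mathcomp Require Import all_classical all_reals all_analysis.

Set Implicit Arguments.
Unset Strict Implicit.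
Unset Printing Implicit Defensive.
Import Order.TTheory GRing.Theory Num.Theory.

Local Open Scope classical_set_scope.
Local Open Scope ring_scope.

Definition locally_finite_metric (R : realType) (Z : metricType R) : Prop :=
  forall (x : Z) (r : R), finite_set (ball x r).

Definition lipschitz_map (R : realType) (X Y : metricType R) (f : X -> Y) :
    Prop :=
  exists2 K : R, 0 <= K & forall x y, mdist (f x) (f y) <= K * mdist x y.

Definition lipschitz_injection (R : realType) (X Y : metricType R)
    (f : X -> Y) : Prop :=
  injective f /\ lipschitz_map f.

Definition sum_powR (R : realType) (p : R) (u : nat -> R) : \bar R :=
  (\sum_(0 <= n <oo) (`|u n| `^ p)%:E)%E.

(* The hypothesis [0 < p] is a parameter of the type so that the metric
   instance below can depend on it. *)
Record ellp (R : realType) (p : R) (p_gt0 : 0 < p) := Ellp {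
  ellp_seq :> nat -> R;
  ellp_summable : (sum_powR p ellp_seq < +oo)%E }.

HB.instance Definition _ R p p_gt0 :=
  [isSub for @ellp_seq R p p_gt0].
HB.instance Definition _ R p p_gt0 :=
  [Choice of @ellp R p p_gt0 by <:].

(* [fine] loses nothing: the series converges by [sum_powRB_fin_num]. *)
Definition ellp_dist (R : realType) (p : R) (p_gt0 : 0 < p)
    (x y : ellp p_gt0) : R :=
  let s := fine (sum_powR p (fun n => x n - y n)) in
  if 1 <= p then s `^ p^-1 else s.

Section ellp_metric.
Context (R : realType) (p : R) (p_gt0 : 0 < p).
Implicit Types (u : nat -> R) (x y z : ellp p_gt0).

Lemma sum_powR_ge0 u : (0 <= sum_powR p u)%E.
Proof. by apply: nneseries_ge0 => n _ _; rewrite lee_fin powR_ge0. Qed.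

Lemma sum_powR_fin_num u : (sum_powR p u < +oo)%E -> sum_powR p u \is a fin_num.
Proof. by move=> uoo; rewrite ge0_fin_numE// sum_powR_ge0. Qed.

Lemma sum_powR_eq0 u : sum_powR p u = 0%E -> u = fun=> 0.
Proof.
move=> u0; apply/funext => n; apply/eqP.
have : (\sum_(0 <= i < n.+1) (`|u i| `^ p)%:E <= sum_powR p u)%E.
  by apply: nneseries_lim_ge => k _ _; rewrite lee_fin powR_ge0.
rewrite u0 big_nat_recr//= => h.
have : ((`|u n| `^ p)%:E <= 0)%E.
  apply: le_trans h; apply: leeDr; apply: sume_ge0 => i _.
  by rewrite lee_fin powR_ge0.
rewrite lee_fin => h0.
have : `|u n| `^ p == 0 by rewrite eq_le h0 powR_ge0.
by rewrite powR_eq0 normr_eq0 => /andP[].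
Qed.

Lemma sum_powRB_fin_num x y : sum_powR p (fun n => x n - y n) \is a fin_num.
Proof.
apply: sum_powR_fin_num.
have xy : (sum_powR p (fun n => (x n - y n)%R) <=
    (2 `^ p)%:E * (sum_powR p x + sum_powR p y))%E.
  rewrite /sum_powR -nneseriesD; last 2 first.
  - by move=> n _ _; rewrite lee_fin powR_ge0.
  - by move=> n _ _; rewrite lee_fin powR_ge0.
  rewrite -nneseriesZl; last first.
    by move=> n _; rewrite -EFinD lee_fin addr_ge0 ?powR_ge0.
  apply: lee_nneseries => n; first by move=> _ _; rewrite lee_fin powR_ge0.
  move=> _; rewrite -EFinD -EFinM lee_fin.
  wlog xy : x y / `|x n| <= `|y n| => [hw|].
    have [/hw//|/ltW/hw] := leP `|x n| `|y n|.
    by rewrite distrC [X in _ * X]addrC.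
  apply: (@le_trans _ _ (2 `^ p * `|y n| `^ p)); last first.
    by rewrite ler_wpM2l ?powR_ge0// lerDr powR_ge0.
  rewrite -powRM//; apply: ge0_ler_powR; rewrite ?nnegrE ?mulr_ge0 ?(ltW p_gt0)//.
  by rewrite (le_trans (ler_normB _ _))// mulr_natl mulr2n lerD2r.
apply: le_lt_trans xy _.
by rewrite lte_mul_pinfty ?lee_fin ?powR_ge0// lte_add_pinfty ?ellp_summable.
Qed.

Lemma ler_powRD (a b : R) : p <= 1 -> 0 <= a -> 0 <= b ->
  (a + b) `^ p <= a `^ p + b `^ p.
Proof.
move=> p1; rewrite le0r => /predU1P[->|a0 b0].
  by rewrite add0r lerDr powR_ge0.
have ab0 : 0 < a + b by rewrite ltr_wpDr.
have key c : 0 <= c -> c <= a + b -> c / (a + b) * (a + b) `^ p <= c `^ p.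
  rewrite le0r => /predU1P[->|c0 cab]; first by rewrite !mul0r powR_ge0.
  rewrite -[in leRHS](divfK (lt0r_neq0 ab0) c) powRM ?divr_ge0 ?(ltW c0) ?(ltW ab0)//.
  rewrite ler_wpM2r ?powR_ge0// ger1_powR// divr_gt0//=.
  by rewrite ler_pdivrMr// mul1r.
rewrite -[leLHS]mul1r -(divff (lt0r_neq0 ab0)) !mulrDl lerD ?key ?(ltW a0)//.
- by rewrite lerDl.
- by rewrite lerDr ltW.
Qed.

Lemma ellp_distxx x : ellp_dist x x = 0.
Proof.
have s0 : sum_powR p (fun n => x n - x n) = 0%E.
  rewrite /sum_powR eseries0// => n _ _.
  by rewrite subrr normr0 powR0 ?gt_eqF.
by rewrite /ellp_dist s0/=; case: ifP => // _; rewrite powR0// invr_eq0 gt_eqF.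
Qed.

Lemma ellp_dist_positivity x y : ellp_dist x y = 0 -> x = y.
Proof.
move=> xy; suff /sum_powR_eq0 h : sum_powR p (fun n => x n - y n) = 0%E.
  apply: val_inj; apply/funext => n /=.
  by apply/eqP; rewrite -subr_eq0; apply/eqP; exact: (congr1 (@^~ n) h).
rewrite -(fineK (sum_powRB_fin_num x y)); congr _%:E; move: xy.
by rewrite /ellp_dist; case: ifP => // _ /powR_eq0_eq0.
Qed.

Lemma ellp_dist_sym x y : ellp_dist x y = ellp_dist y x.
Proof.
rewrite /ellp_dist /sum_powR.
by under eq_eseriesr do rewrite distrC.
Qed.

Lemma ellp_dist_Lnorm x y : 1 <= p ->
  ((ellp_dist x y)%:E = 'N[counting]_p%:E[EFin \o (fun n => x n - y n)%R])%E.
Proof.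
move=> p1; rewrite Lnorm_counting// /ellp_dist p1 -poweR_EFin.
by rewrite fineK ?sum_powRB_fin_num.
Qed.

Lemma ellp_dist_triangle y x z :
  ellp_dist x z <= ellp_dist x y + ellp_dist y z.
Proof.
have xz n : x n - z n = (x n - y n) + (y n - z n) by rewrite addrA subrK.
have [p1|p1] := leP 1 p.
  rewrite -lee_fin EFinD !ellp_dist_Lnorm//.
  under [X in Lnorm _ _ (_ \o X)]eq_fun do rewrite xz.
  exact: minkowski_EFin.
rewrite /ellp_dist (lt_geF p1) -lee_fin EFinD !fineK ?sum_powRB_fin_num//.
rewrite /sum_powR -nneseriesD; last 2 first.
- by move=> n _ _; rewrite lee_fin powR_ge0.
- by move=> n _ _; rewrite lee_fin powR_ge0.
apply: lee_nneseries => n; first by move=> _ _; rewrite lee_fin powR_ge0.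
move=> _; rewrite -EFinD lee_fin xz (le_trans _ (ler_powRD (ltW p1) _ _))//.
by apply: ge0_ler_powR; rewrite ?nnegrE ?addr_ge0 ?(ltW p_gt0)// ler_normD.
Qed.

HB.instance Definition _ := isMetric.Build R (ellp p_gt0)
  ellp_distxx ellp_dist_positivity ellp_dist_sym ellp_dist_triangle.

Lemma ellp_mdistE x y : mdist x y = ellp_dist x y.
Proof. by []. Qed.

End ellp_metric.

(* Main.v *)
Require Import Defs.
From mathcomp Require Import all_boot all_order all_algebra.
From mathcomp Require Import all_classical all_reals all_analysis.
Import Order.TTheory GRing.Theory Num.Theory.
Local Open Scope ring_scope.

(** In a locally finite space every point z is at some distance at least
    delta z > 0 from all the others, so d(x, y) >= max (delta x) (delta y)
    whenever x <> y. The space is countable; send its n-th point to a multiple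
    of the n-th unit vector lying at distance delta z from the origin. Then the
    images of x <> y are at distance at most delta x + delta y <= 2 d(x, y). *)

(** The unit ball around z is finite, so the distances from z to its other points have a positive
    minimum. Capping it at 1 covers the points outside the ball. *)
Lemma locally_finite_isolated (R : realType) (Z : metricType R) :
  locally_finite_metric Z -> forall z : Z,
  exists2 e : R, 0 < e & forall y, y != z -> e <= mdist z y.
Proof.
move=> Z_lf z; have /finite_seqP[s zs] := Z_lf z 1.
exists (\big[Num.min/1]_(y <- s | y != z) mdist z y).
  by apply: lt_bigmin => // y yz; rewrite mdist_gt0 eq_sym.
move=> y yz; have [zy1|] := ltP (mdist z y) 1.
  apply: ge_bigmin_seq => //.
  by have : ball z 1%R y; [rewrite ballEmdist | rewrite zs].
by apply: le_trans; exact: bigmin_le_id.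
Qed.

Lemma locally_finite_countable (R : realType) (Z : metricType R) :
  locally_finite_metric Z -> countable [set: Z].
Proof.
move=> Z_lf; have [[z _]|/set0P/negP] := pselect ([set: Z] !=set0)%classic; last first.
  by rewrite negbK => /eqP ->; exact: countable0.
have -> : [set: Z]%classic = (\bigcup_(n in [set: nat]) ball z n%:R)%classic.
  apply/seteqP; split => // y _.
  (* Balls are open, so the radius must strictly exceed the distance. *)
  exists (Num.truncn (mdist z y)).+1 => //.
  by rewrite ballEmdist /= truncnS_gt.
by apply: bigcup_countable => // n _; exact/finite_set_countable/Z_lf.
Qed.

Section spike.
Context (R : realType) (p : R) (p_gt0 : 0 < p).

Lemma sum_powR_spike (n : nat) (c : R) :
  sum_powR p (fun k => if k == n then c else 0) = (`|c| `^ p)%:E.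
Proof.
rewrite /sum_powR (@nneseriesD1 _ _ n) => [||//]; last first.
  by move=> k _; rewrite lee_fin powR_ge0.
rewrite eqxx eseries0 ?adde0// => k _ /= /negbTE ->.
(* Here [p != 0] matters, since a zero base with exponent 0 gives 1. *)
by rewrite normr0 powR0// gt_eqF.
Qed.

Definition spike (n : nat) (c : R) : ellp p_gt0.
Proof.
by exists (fun k => if k == n then c else 0); rewrite sum_powR_spike ltry.
Defined.

(** Lets the origin be written with the index of whichever point it is compared to. *)
Lemma spike0 (m n : nat) : spike m 0 = spike n 0.
Proof. by apply: val_inj; apply/funext => k /=; rewrite !if_same. Qed.

(** Coordinate m is nonzero on the left, and on the right only coordinate n can be. *)
Lemma spike_inj (m n : nat) (a b : R) :
  a != 0 -> spike m a = spike n b -> m = n.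
Proof.
move=> a0 /(congr1 (fun u => ellp_seq u m)) /=; rewrite eqxx.
by case: eqP => // _ /eqP; rewrite (negbTE a0).
Qed.

Lemma exists_spike_mdist (n : nat) (e : R) : 0 < e ->
  exists2 c : R, c != 0 & mdist (spike n c) (spike n 0) = e.
Proof.
move=> e0.
have distE c : 0 < c ->
    mdist (spike n c) (spike n 0) = if 1 <= p then c else c `^ p.
  move=> c0; rewrite ellp_mdistE /ellp_dist /=.
  have -> : (fun k => (if k == n then c else 0) - (if k == n then 0 else 0)) =
      (fun k => if k == n then c else 0).
    by apply/funext => k; rewrite if_same subr0.
  rewrite sum_powR_spike gtr0_norm//=; case: ifP => // _.
  by rewrite -powRrM divff ?gt_eqF// powRr1// ltW.
(* For p < 1 the metric takes no p-th root, so the height must be the p-th root of e. *)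
exists (if 1 <= p then e else e `^ p^-1).
  by case: ifP => _; rewrite gt_eqF// powR_gt0.
rewrite distE; last by case: ifP => // _; rewrite powR_gt0.
by case: (1 <= p) => //; rewrite -powRrM mulVf ?gt_eqF// powRr1 ?ltW.
Qed.

End spike.

Theorem mainTheorem7 (R : realType) (Z : metricType R)
    (Z_lf : locally_finite_metric Z) (p : R) (p_gt0 : 0 < p) :
  exists f : Z -> ellp p_gt0, lipschitz_injection f.
Proof.
have /countable_injP[idx idx_inj] := locally_finite_countable _ _ Z_lf.
have /choice[g gP] : forall z : Z, exists c : R, c != 0 /\
    forall y, y != z ->
      mdist (spike _ _ p_gt0 (idx z) c) (spike _ _ p_gt0 (idx z) 0) <= mdist z y.
  move=> z; have [e e0 ez] := locally_finite_isolated _ _ Z_lf z.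
  have [c c0 ce] := exists_spike_mdist _ _ p_gt0 (idx z) _ e0.
  by exists c; split=> // y /ez; rewrite ce.
exists (fun z => spike _ _ p_gt0 (idx z) (g z)); split.
  move=> x y /spike_inj xy; apply: idx_inj; rewrite ?inE//.
  by apply: xy; case: (gP x).
exists 2 => // x y; have [->|xy] := eqVneq x y; first by rewrite !mdistxx mulr0.
(* Pass through the origin: each leg is at most [mdist x y], by the choice of [g] at x and at y
   respectively. *)
apply: le_trans (metric_triangle _ (spike _ _ p_gt0 0%N 0) _) _.
rewrite mulr_natl mulr2n lerD//.
  by rewrite (spike0 _ _ _ _ (idx x)); apply: (gP x).2; rewrite eq_sym.
by rewrite (spike0 _ _ _ _ (idx y)) metric_sym [leRHS]metric_sym; apply: (gP y).2.
Qed.
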